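(* Let $0<p<q\leq\infty$, set $\alpha=1/p-1/q$, and let $m,n\in\mathbb{N}$ with $2\leq n\leq m\leq 2^{n}$. Let $X,Y$ be $r$-normed quasi-Banach spaces (for some $r\in(0,1]$) and let $T_{0}:X\to Y$ be a bounded linear operator. Let $T(m):l_{p}^{m}(X)\rightarrow l_{q}^{m}(Y)$ be the linear operator defined by $T(m)(x)=\left(T_{0}(x_{1}),\dots,T_{0}(x_{m})\right)$ for $x=(x_{1},\dots,x_{m})\in l_{p}^{m}(X)$. Then \[ c_{1}A(n,m,T_{0})\leq e_{n}(T(m))\leq c_{2}A(n,m,T_{0}), \] where $c_{1},c_{2}$ are positive constants depending only on $p,q$ and $r$, and \[ A(n,m,T_{0})=\max\left(\left\Vert T_{0}\right\Vert \left(\frac{\log(m/n)+1}{n}\right)^{\alpha},\ \max_{k\in\{1,2,\dots,n\}}\left((k/n)^{\alpha}e_{k}(T_{0})\right)\right). \]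
   Context: $\log$ denotes $\log_2$. A quasi-Banach space $Z$ is $r$-normed ($0<r\le 1$) if $\|z_1+z_2\|^r\le \|z_1\|^r+\|z_2\|^r$ for all $z_1,z_2\in Z$. For a quasi-Banach space $X$ and $m\in\mathbb{N}$, $0<p\le\infty$, $l_p^m(X)$ is the space of $m$-tuples $x=(x_1,\dots,x_m)$ with $x_i\in X$, quasi-normed by $(\sum_{i=1}^m\|x_i\|_X^p)^{1/p}$ (and $\max_i\|x_i\|_X$ if $p=\infty$). For a bounded linear operator $T:X\to Y$ between quasi-Banach spaces and $n\in\mathbb{N}$, the $n$-th (dyadic) entropy number $e_n(T)$ is the infimum of all $\varepsilon>0$ such that $T(B_X)$ (image of the closed unit ball of $X$) can be covered by $2^{n-1}$ balls in $Y$ of radius $\varepsilon$; $\|T\|$ is the operator quasi-norm. *)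

(* Defs.v *)
From HB Require Import structures.
From mathcomp Require Import all_boot all_order all_algebra.
From mathcomp Require Import all_classical all_reals.
From mathcomp Require Import exp.
Set Implicit Arguments. Unset Strict Implicit. Unset Printing Implicit Defensive.
Import Order.TTheory GRing.Theory Num.Theory Num.Def.
Local Open Scope ring_scope.
Local Open Scope classical_set_scope.

Section Defs.
Variable R : realType.

Definition log2 (x : R) : R := ln x / ln 2.

Definition quasi_norm (V : lmodType R) (N : V -> R) : Prop :=
  [/\ forall x, 0 <= N x,
      forall x, N x = 0 -> x = 0,
      forall (a : R) x, N (a *: x) = `|a| * N x &
      exists C : R, 1 <= C /\ forall x y, N (x + y) <= C * (N x + N y)].

Definition r_normed (V : lmodType R) (r : R) (N : V -> R) : Prop :=
  forall x y, N (x + y) `^ r <= N x `^ r + N y `^ r.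

Definition qcomplete (V : lmodType R) (N : V -> R) : Prop :=
  forall u : nat -> V,
    (forall e : R, 0 < e -> exists K, forall i j, (K <= i)%N -> (K <= j)%N ->
        N (u i - u j) < e) ->
    exists l, forall e : R, 0 < e -> exists K, forall i, (K <= i)%N -> N (u i - l) < e.

Definition rnormed_qBanach (r : R) (V : lmodType R) (N : V -> R) : Prop :=
  [/\ quasi_norm N, qcomplete N & r_normed r N].

Definition bounded_op (U V : Type) (NU : U -> R) (NV : V -> R) (T : U -> V) : Prop :=
  exists C : R, forall x, NV (T x) <= C * NU x.

Definition opnorm (U V : Type) (NU : U -> R) (NV : V -> R) (T : U -> V) : R :=
  sup [set NV (T x) | x in [set x | NU x <= 1]].

Definition entropy (U : Type) (V : zmodType) (NU : U -> R) (NV : V -> R)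
  (T : U -> V) (n : nat) : R :=
  inf [set eps : R | 0 < eps /\
        exists c : 'I_(2 ^ n.-1) -> V,
          forall x, NU x <= 1 -> exists i, NV (T x - c i) <= eps].

(* l_s^m quasi-norm of a family of nonnegative reals, s in (0, +oo] *)
Definition lpnorm (m : nat) (s : \bar R) (f : 'I_m -> R) : R :=
  match s with
  | EFin s => (\sum_(i < m) f i `^ s) `^ s^-1
  | +oo%E => \big[maxr/0]_(i < m) (f i)
  | -oo%E => 0
  end.

Definition inv_exp (s : \bar R) : R :=
  match s with EFin s => s^-1 | _ => 0 end.

Definition lp_vec (X : lmodType R) (NX : X -> R) (m : nat) (s : \bar R)
  (x : {ffun 'I_m -> X}) : R := lpnorm s (fun i => NX (x i)).

Definition diag_op (X Y : lmodType R) (T0 : X -> Y) (m : nat)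
  (x : {ffun 'I_m -> X}) : {ffun 'I_m -> Y} := [ffun i => T0 (x i)].

Definition Aquant (alpha : R) (n m : nat) (opn : R) (e : nat -> R) : R :=
  maxr (opn * ((log2 (m%:R / n%:R) + 1) / n%:R) `^ alpha)
          (\big[maxr/0]_(k < n) (((k.+1)%:R / n%:R) `^ alpha * e k.+1)).

End Defs.

(* Main.v *)
(** Lower bound.  Let T(B_X), or T(B) for the unit ball B of b copies of X, contain
    about 2^s points that are pairwise t-separated.  Words of length l over these
    points, with 2n <= s l and normalised by l^(-1/p), lie in the unit ball of
    l_p^m(X); by pigeonhole over Hamming balls, two words with the same centre differ
    in at least l/2 letters, hence the radius is at least c t l^(-alpha).  Multiples of
    a nearly norming vector at b positions give the term with the operator norm, and
    e_k(T)-separated points of T(B_X) give the term with e_k(T); for k < 5 the latter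
    is dominated by the former.

    Upper bound.  With t ~ log(m/n) + 1 and N ~ n/t, record the integers
    a_i = floor (N |x_i|^p), whose sum is at most N.  There are at most 2^(O(n))
    such patterns, and the i-th coordinate may be spent a_i t bits, n in total up to a
    constant; the error this leaves at i is of order A |x_i|^(p/q).  All implied
    constants are chosen so that at most 2^(n-1) centres are needed. *)
Require Import Defs.
From HB Require Import structures.
From mathcomp Require Import all_boot all_order all_algebra.
From mathcomp Require Import all_classical all_reals.
From mathcomp Require Import exp.
From mathcomp Require Import ring lra zify.
Import Order.TTheory GRing.Theory Num.Theory.
Local Open Scope ring_scope.
Set Implicit Arguments. Unset Strict Implicit. Unset Printing Implicit Defensive.

(** * Counting words, Hamming balls and integer patterns *)

Lemma card_agree_off (A : finType) (l : nat) (w : {ffun 'I_l -> A}) (S : {set 'I_l}) :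
  #|[set v : {ffun 'I_l -> A} | [forall j, (j \notin S) ==> (v j == w j)]]|
    = (#|A| ^ #|S|)%N.
Proof.
rewrite (_ : #|_| = #|family (fun j : 'I_l => if j \in S then predT else pred1 (w j))|).
  rewrite card_family foldrE big_map big_enum /=.
  rewrite (bigID (fun j => j \in S)) /= [X in (_ * X)%N]big1 ?muln1.
    rewrite (eq_bigr (fun=> #|A|)) => [|j ->]; last by apply: eq_card => v; rewrite !inE.
    by rewrite prod_nat_const.
  by move=> j /negbTE ->; rewrite card1.
apply: eq_card => v; rewrite inE; apply/forallP/familyP => H j; have := H j.
  by case: ifP => //= _; rewrite inE.
by case: ifP => //= _; rewrite inE.
Qed.

(** A word at distance less than l/2 agrees with [w] off some set of fewer than l/2 indices; there
    are at most 2^l such sets, each leaving at most |A|^(l/2) words. *)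
Lemma card_hamming_ball (A : finType) (l : nat) (w : {ffun 'I_l -> A}) :
  (0 < #|A|)%N ->
  (#|[set v : {ffun 'I_l -> A} | (2 * #|[set j | w j != v j]| < l)%N]|
    <= 2 ^ l * #|A| ^ l./2)%N.
Proof.
move=> A0.
pose P := [set S : {set 'I_l} | (2 * #|S| < l)%N].
pose F (S : {set 'I_l}) :=
  [set v : {ffun 'I_l -> A} | [forall j, (j \notin S) ==> (v j == w j)]].
apply: (@leq_trans #|\bigcup_(S in P) F S|).
  apply/subset_leq_card/fintype.subsetP => v; rewrite inE => Hv.
  apply/bigcupP; exists [set j | w j != v j]; first by rewrite inE.
  rewrite inE; apply/forallP => j; rewrite inE negbK eq_sym.
  exact/implyP.
apply: (@leq_trans (\sum_(S in P) #|F S|)%N).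
  apply: (big_ind2 (fun (X : {set {ffun 'I_l -> A}}) k => #|X| <= k)%N) => //.
    by rewrite cards0.
  move=> X1 k1 X2 k2 H1 H2; apply: leq_trans (leq_add H1 H2).
  by rewrite cardsU leq_subr.
apply: (@leq_trans (\sum_(S in P) #|A| ^ l./2)%N).
  apply: leq_sum => S; rewrite inE card_agree_off => HS.
  by rewrite leq_pexp2l //; lia.
rewrite sum_nat_const leq_mul2r; apply/orP; right.
apply: leq_trans (max_card _) _.
by rewrite -cardsT -powersetT card_powerset cardsT card_ord.
Qed.

(** Otherwise every fibre of [f] would lie in a Hamming ball, so |A|^l <= 2^(n-1) 2^l |A|^(l/2).
    Squaring and cancelling gives |A|^l <= 4^(n-1) 4^l, while the hypotheses give |A|^l >= 4^l
    2^(sl) >= 4^l 4^n. *)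
Lemma hamming_pigeonhole (A : finType) (n l s : nat)
    (f : {ffun 'I_l -> A} -> 'I_(2 ^ n.-1)) :
  (0 < n)%N -> (4 * 2 ^ s <= #|A|)%N -> (2 * n <= s * l)%N ->
  exists w v, f w = f v /\ (l <= 2 * #|[set j | w j != v j]|)%N.
Proof.
move=> n0 NA sl; apply/not_existsP => H.
have A0 : (0 < #|A|)%N by apply: leq_trans NA; rewrite muln_gt0 expn_gt0.
have Hc i : (#|[set w | f w == i]| <= 2 ^ l * #|A| ^ l./2)%N.
  have [->|[w]] := set_0Vmem [set w | f w == i]; first by rewrite cards0.
  rewrite inE => /eqP fw; apply: leq_trans (card_hamming_ball w A0).
  apply/subset_leq_card/fintype.subsetP => v; rewrite !inE => /eqP fv.
  rewrite ltnNge; apply/negP => C; apply: (H w); exists v.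
  by rewrite fw fv.
have Htot : (#|A| ^ l <= 2 ^ n.-1 * (2 ^ l * #|A| ^ l./2))%N.
  have -> : (#|A| ^ l)%N = #|{ffun 'I_l -> A}| by rewrite card_ffun card_ord.
  rewrite -sum1_card (partition_big f predT) //=.
  apply: (@leq_trans (\sum_(i < 2 ^ n.-1) 2 ^ l * #|A| ^ l./2)%N).
    apply: leq_sum => i _; rewrite sum1dep_card; exact: Hc.
  by rewrite sum_nat_const card_ord.
have H2 : (#|A| ^ l <= 4 ^ n.-1 * 4 ^ l)%N.
  have Al0 : (0 < #|A| ^ l)%N by rewrite expn_gt0 A0.
  rewrite -(leq_pmul2r Al0).
  apply: (@leq_trans ((2 ^ n.-1 * (2 ^ l * #|A| ^ l./2)) ^ 2)%N).
    by rewrite -mulnn leq_mul.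
  rewrite !expnMn -!expnM ![(_ * 2)%N]mulnC !expnM -[(2 ^ 2)%N]/4%N -mulnA.
  rewrite !leq_pmul2l ?expn_gt0 // -expnM leq_pexp2l //.
  lia.
have H3 : (4 ^ l * 4 ^ n <= #|A| ^ l)%N.
  apply: (@leq_trans ((4 * 2 ^ s) ^ l)%N); last by rewrite leq_exp2r //; lia.
  rewrite expnMn leq_pmul2l ?expn_gt0 // -expnM -[4%N]/(2 ^ 2)%N -expnM.
  by rewrite leq_pexp2l.
have := leq_trans H3 H2; rewrite mulnC leq_pmul2r ?expn_gt0 // leq_exp2l //; lia.
Qed.

(** Each of the n factors of (2n)!/n! is at least n, and (2n)!/n! is n! times a central binomial
    coefficient, itself at most 4^n. *)
Lemma expn_leq_fact n : (n ^ n <= 4 ^ n * n`!)%N.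
Proof.
have H : (n ^ n <= (n + n) ^_ n)%N.
  rewrite ffact_prod -[X in (_ ^ X <= _)%N](card_ord n) -prod_nat_const.
  by apply: leq_prod => i _; have := ltn_ord i; lia.
apply: leq_trans H _; rewrite -bin_ffact leq_mul2r; apply/orP; right.
have -> : (4 ^ n = \sum_(i < (n + n).+1) 'C(n + n, i))%N.
  rewrite -[4%N]/((1 + 1) ^ 2)%N -expnM mul2n -addnn expnDn.
  by apply: eq_bigr => i _; rewrite !exp1n !muln1.
have lt : (n < (n + n).+1)%N by lia.
by rewrite (bigD1 (Ordinal lt)) //= leq_addr.
Qed.

(** The numerator of the binomial is at most (2m)^N, and N! >= (N/4)^N, so the quotient is at most
    (8m/N)^N. *)
Lemma bin_leq_expn m N K : (N <= m)%N -> (m <= K * N)%N ->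
  ('C(m + N, N) <= (8 * K) ^ N)%N.
Proof.
move=> Nm mK.
have [->|N0] := posnP N; first by rewrite bin0.
have ff : ((m + N) ^_ N <= (2 * m) ^ N)%N.
  rewrite ffact_prod -[X in (_ <= _ ^ X)%N](card_ord N) -prod_nat_const.
  by apply: leq_prod => i _; lia.
rewrite -(@leq_pmul2r (N ^ N)) ?expn_gt0 ?N0 //.
apply: leq_trans (leq_mul (leqnn _) (expn_leq_fact N)) _.
rewrite mulnCA bin_ffact -expnMn.
apply: leq_trans (leq_mul (leqnn _) ff) _.
by rewrite -expnMn leq_exp2r //; lia.
Qed.

(** For a fixed first component [a] the second has at most 2^(t a_1) ... 2^(t a_m) <= 2^(Nt)
    choices; the tuples [a] of sum at most N are counted by the binomial coefficient. *)
Lemma card_weighted_patterns (m N t K : nat) : (N <= m)%N ->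
  (#|[set x : m.-tuple 'I_N.+1 * {ffun 'I_m -> 'I_K} |
      (\sum_i tnth x.1 i <= N)%N && [forall i, (x.2 i < 2 ^ (tnth x.1 i * t))%N]]|
   <= 'C(m + N, N) * 2 ^ (N * t))%N.
Proof.
move=> Nm.
rewrite -sum1dep_card (eq_bigl (fun x : m.-tuple 'I_N.+1 * {ffun 'I_m -> 'I_K} =>
   (\sum_i tnth x.1 i <= N)%N && [forall i, (x.2 i < 2 ^ (tnth x.1 i * t))%N])) //.
rewrite -(pair_big_dep (fun a : m.-tuple 'I_N.+1 => (\sum_i tnth a i <= N)%N)
  (fun a (f : {ffun 'I_m -> 'I_K}) => [forall i, (f i < 2 ^ (tnth a i * t))%N])
  (fun _ _ => 1%N)) /=.
apply: (@leq_trans (\sum_(a : m.-tuple 'I_N.+1 | (\sum_i tnth a i <= N)%N)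
   2 ^ (N * t))%N).
  apply: leq_sum => a Ha; rewrite sum1dep_card.
  rewrite (_ : #|_| =
      #|family (fun i : 'I_m => [pred j : 'I_K | (j < 2 ^ (tnth a i * t))%N])|);
    last by apply: eq_card => f; rewrite inE; apply/forallP/familyP => H i; have := H i.
  rewrite card_family foldrE big_map big_enum /=.
  apply: (@leq_trans (\prod_(i : 'I_m) 2 ^ (tnth a i * t))%N).
    apply: leq_prod => i _.
    rewrite cardE -(size_map val) -[X in (_ <= X)%N](size_iota 0).
    apply: uniq_leq_size; first by rewrite map_inj_uniq ?enum_uniq //; exact: val_inj.
    move=> x /mapP[j]; rewrite mem_enum => Hj ->; rewrite mem_iota add0n; exact: Hj.
  rewrite -expn_sum leq_pexp2l // -big_distrl /= leq_mul2r Ha orbT //.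
rewrite sum_nat_cond_const leq_mul2r; apply/orP; right.
rewrite (_ : 'C(m + N, N) = 'C(m + N, m)); last by rewrite -bin_sub ?leq_addl // addnK.
rewrite -card_partial_ord_partitions; apply: eq_leq; apply: eq_card => a.
by rewrite !inE big_tuple.
Qed.

(** * Real powers and estimates of the l_q quasi-norm *)

Lemma ler_powR2 (R : realType) (x y a : R) :
  0 <= a -> 0 <= x -> x <= y -> x `^ a <= y `^ a.
Proof. by move=> a0 x0 xy; apply: ge0_ler_powR => //; rewrite nnegrE ?(le_trans x0). Qed.

Lemma powRVK (R : realType) (x a : R) : 0 <= x -> a != 0 -> (x `^ a) `^ a^-1 = x.
Proof. by move=> x0 a0; rewrite -powRrM divff // powRr1. Qed.

Lemma powRKV (R : realType) (x a : R) : 0 <= x -> a != 0 -> (x `^ a^-1) `^ a = x.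
Proof. by move=> x0 a0; rewrite -powRrM mulVf // powRr1. Qed.

(** The weights [u] distribute a unit mass over the coordinates; taking s-th powers reduces the
    claim to their sum. For q infinite [inv_exp q] is 0, so the same hypothesis reads f <= C. *)
Lemma lpnorm_le (R : realType) (m : nat) (q : \bar R) (f u : 'I_m -> R) (C : R) :
  (0 < q)%E -> 0 <= C -> (forall i, 0 <= u i) -> \sum_i u i <= 1 ->
  (forall i, 0 <= f i) -> (forall i, f i <= C * u i `^ inv_exp q) ->
  lpnorm q f <= C.
Proof.
case: q => [s||] //=; last first.
  move=> _ C0 _ _ _ H; apply: bigmax_le => // i _.
  by apply: le_trans (H i) _; rewrite powRr0 mulr1.
rewrite lte_fin => s0 C0 u0 u1 f0 H.
rewrite -[leRHS](@powRVK _ _ s) ?gt_eqF //.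
apply: ler_powR2; first by rewrite invr_ge0 ltW.
  by apply: sumr_ge0 => i _; exact: powR_ge0.
apply: (@le_trans _ _ (\sum_i C `^ s * u i)).
  apply: ler_sum => i _.
  apply: le_trans (ler_powR2 (ltW s0) (f0 i) (H i)) _.
  by rewrite powRM ?powR_ge0 // powRKV ?gt_eqF.
by rewrite -mulr_sumr ler_piMr ?powR_ge0.
Qed.

Lemma lpnorm_ge_card (R : realType) (m : nat) (q : \bar R) (f : 'I_m -> R)
    (D : {set 'I_m}) (t : R) :
  (0 < q)%E -> 0 <= t -> (forall i, 0 <= f i) -> (0 < #|D|)%N ->
  (forall i, i \in D -> t <= f i) ->
  t * #|D|%:R `^ inv_exp q <= lpnorm q f.
Proof.
case: q => [s||] //=; last first.
  move=> _ t0 f0 /card_gt0P[i iD] H; rewrite powRr0 mulr1.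
  by apply: le_trans (H i iD) _; apply: le_bigmax.
rewrite lte_fin => s0 t0 f0 _ H.
rewrite -[X in X * _](@powRVK _ _ s) ?gt_eqF // -powRM ?powR_ge0 //.
apply: ler_powR2; rewrite ?invr_ge0 ?(ltW s0) ?mulr_ge0 ?powR_ge0 //.
rewrite mulr_natr -sumr_const.
rewrite [leRHS](bigID (fun i => i \in D)) /= ler_wpDr //.
  by apply: sumr_ge0 => i _; exact: powR_ge0.
by apply: ler_sum => i iD; apply: ler_powR2 (ltW s0) t0 (H i iD).
Qed.

(** * Quasi-norms, coverings, entropy numbers and the operator norm *)

Section QuasiNorm.
Variables (R : realType) (V : lmodType R) (N : V -> R).
Hypothesis qN : quasi_norm N.

Lemma qnorm_ge0 x : 0 <= N x. Proof. by case: qN. Qed.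

Lemma qnormZ a x : N (a *: x) = `|a| * N x. Proof. by case: qN. Qed.

Lemma qnorm0 : N 0 = 0.
Proof. by rewrite -[X in N X](scale0r 0) qnormZ normr0 mul0r. Qed.

Lemma qnormN x : N (- x) = N x.
Proof. by rewrite -scaleN1r qnormZ normrN normr1 mul1r. Qed.

(** If both distances to [c] were below t / 2^(1/r), their r-th powers would add up to less than
    t^r, against the r-triangle inequality. *)
Lemma r_normed_split (r t : R) (x y c : V) : 0 < r -> r_normed r N -> 0 <= t ->
  t <= N (x - y) ->
  t / 2 `^ r^-1 <= N (x - c) \/ t / 2 `^ r^-1 <= N (y - c).
Proof.
move=> r0 rN t0 txy.
case: (leP (t / 2 `^ r^-1) (N (x - c))) => [|xc]; first by left.
case: (leP (t / 2 `^ r^-1) (N (y - c))) => [|yc]; first by right.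
exfalso.
have tr : 2 * (t / 2 `^ r^-1) `^ r = t `^ r.
  rewrite powRM ?invr_ge0 ?powR_ge0 // -powRN -powRrM mulNr mulVf ?gt_eqF //.
  by rewrite powR_inv1 // mulrCA divff ?mulr1 // pnatr_eq0.
have h1 : N (x - c) `^ r < (t / 2 `^ r^-1) `^ r.
  by apply: gt0_ltr_powR => //; rewrite nnegrE ?qnorm_ge0 // divr_ge0 ?powR_ge0.
have h2 : N (c - y) `^ r < (t / 2 `^ r^-1) `^ r.
  rewrite -opprB qnormN.
  by apply: gt0_ltr_powR => //; rewrite nnegrE ?qnorm_ge0 // divr_ge0 ?powR_ge0.
have h3 := ler_powR2 (ltW r0) t0 txy.
have := rN (x - c) (c - y); rewrite addrA subrK; lra.
Qed.

End QuasiNorm.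

(** The covering condition inside [entropy], to which it unfolds, with the number of balls left
    free. *)
Definition ball_cover (R : realType) (U : Type) (V : zmodType) (NU : U -> R)
    (NV : V -> R) (T : U -> V) (K : nat) (eps : R) : Prop :=
  exists c : 'I_K -> V, forall x, NU x <= 1 -> exists i, NV (T x - c i) <= eps.

Section Entropy.
Variables (R : realType) (U : Type) (V : zmodType) (NU : U -> R) (NV : V -> R).
Variables (T : U -> V) (n : nat).

Lemma entropy_le eps : 0 < eps -> ball_cover NU NV T (2 ^ n.-1) eps ->
  entropy NU NV T n <= eps.
Proof. by move=> e0 H; apply: ge_inf => //; exists 0 => x [/ltW]. Qed.

Lemma ball_cover_bound C : (forall x, NU x <= 1 -> NV (T x) <= C) ->
  ball_cover NU NV T (2 ^ n.-1) C.
Proof.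
move=> HC; have i0 : (0 < 2 ^ n.-1)%N by rewrite expn_gt0.
by exists (fun=> 0) => x /HC xC; exists (Ordinal i0); rewrite subr0.
Qed.

(** The cover of radius [C] shows that the set of admissible radii is nonempty; the infimum of the
    empty set is 0 by convention. *)
Lemma le_entropy a C : 0 < C -> ball_cover NU NV T (2 ^ n.-1) C ->
  (forall eps, 0 < eps -> ball_cover NU NV T (2 ^ n.-1) eps -> a <= eps) ->
  a <= entropy NU NV T n.
Proof.
move=> C0 HC H; apply: lb_le_inf => [|e [e0 cov]]; last exact: H.
by exists C.
Qed.

Lemma entropy_lt_cover b C : 0 < C -> ball_cover NU NV T (2 ^ n.-1) C ->
  entropy NU NV T n < b -> ball_cover NU NV T (2 ^ n.-1) b.
Proof.
move=> C0 HC /inf_lt[]; first by exists C.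
move=> e [e0 [c Hc]] eb; exists c => x /Hc[i Hi].
by exists i; apply: le_trans Hi (ltW eb).
Qed.

Lemma not_ball_cover eps : 0 < eps -> eps < entropy NU NV T n ->
  ~ ball_cover NU NV T (2 ^ n.-1) eps.
Proof. by move=> e0 lt /(entropy_le e0); rewrite leNgt lt. Qed.

Lemma entropy_le_bound C : 0 <= C -> (forall x, NU x <= 1 -> NV (T x) <= C) ->
  entropy NU NV T n <= C.
Proof.
move=> C0 HC; apply/ler_addgt0Pl => e e0.
apply: entropy_le; first by rewrite ltr_wpDr.
by apply: ball_cover_bound => x /HC xC; rewrite (le_trans xC) // lerDr ltW.
Qed.

Lemma entropy_ge0 : 0 <= entropy NU NV T n.
Proof.
rewrite /entropy; set S := (X in inf X).
have [->|/set0P ne] := eqVneq S set0; first by rewrite inf0.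
by apply: lb_le_inf => // x [/ltW].
Qed.

End Entropy.

Section OpNorm.
Variables (R : realType) (X Y : lmodType R) (NX : X -> R) (NY : Y -> R).
Variable T : {linear X -> Y}.
Hypotheses (qX : quasi_norm NX) (qY : quasi_norm NY) (bT : bounded_op NX NY T).

Lemma has_sup_opnorm : has_sup [set NY (T x) | x in [set x | NX x <= 1]]%classic.
Proof.
split; first by exists (NY (T 0)), 0; rewrite //= (qnorm0 qX).
case: bT => C HC; exists `|C| => _ [x /= x1 <-].
apply: le_trans (HC x) _; apply: le_trans (ler_norm _) _.
by rewrite normrM (ger0_norm (qnorm_ge0 qX x)) ler_piMr.
Qed.

Lemma opnorm_ge1 x : NX x <= 1 -> NY (T x) <= opnorm NX NY T.
Proof.
move=> x1; apply: ub_le_sup; first by case: has_sup_opnorm.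
by exists x.
Qed.

Lemma opnorm_ge0 : 0 <= opnorm NX NY T.
Proof.
by apply: le_trans (qnorm_ge0 qY (T 0)) (opnorm_ge1 _); rewrite (qnorm0 qX).
Qed.

Lemma opnorm_ge x : NY (T x) <= opnorm NX NY T * NX x.
Proof.
have [/eqP x0|x0] := eqVneq (NX x) 0.
  have -> : x = 0 by case: qX => _ h _ _; apply/h/eqP.
  by rewrite linear0 (qnorm0 qX) (qnorm0 qY) mulr0.
have p0 : 0 < NX x by rewrite lt0r x0 (qnorm_ge0 qX).
have := @opnorm_ge1 ((NX x)^-1 *: x).
rewrite (linearZ_LR T) (qnormZ qX) (qnormZ qY) ger0_norm ?invr_ge0 ?(ltW p0) //.
by rewrite mulVf // lexx mulrC ler_pdivrMr // => /(_ isT).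
Qed.

Lemma opnorm_half : exists x, NX x <= 1 /\ opnorm NX NY T / 2 <= NY (T x).
Proof.
have [o0|] := leP (opnorm NX NY T) 0.
  exists 0; rewrite (qnorm0 qX) ler01; split => //.
  by apply: le_trans (qnorm_ge0 qY _); lra.
move=> o0; have := sup_adherent _ has_sup_opnorm.
have o2 : 0 < opnorm NX NY T / 2 by lra.
move=> /(_ _ o2)[_ [x x1 <-] H]; exists x; split => //.
by apply: le_trans (ltW H); rewrite -/(opnorm NX NY T); lra.
Qed.

End OpNorm.

(** * Lower bound: separated points and words over them *)

(** Greedy choice: the images of the [K] points listed so far do not form a cover, so some new point
    is far from all of them. Places not yet treated hold arbitrary points of the unit ball. *)
Lemma separated_points (R : realType) (X Y : lmodType R) (NX : X -> R) (NY : Y -> R)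
    (T : X -> Y) (K : nat) (t : R) :
  (exists x, NX x <= 1) -> ~ ball_cover NX NY T K t ->
  exists v : 'I_K -> X, (forall i, NX (v i) <= 1) /\
    forall i j : 'I_K, (j < i)%N -> t <= NY (T (v i) - T (v j)).
Proof.
move=> [x0 Hx0] nc.
suff H (k : nat) : (k <= K)%N -> exists v : 'I_K -> X, (forall i, NX (v i) <= 1) /\
    forall i j : 'I_K, (j < i < k)%N -> t <= NY (T (v i) - T (v j)).
  have [v [v1 Hv]] := H K (leqnn _); exists v; split => // i j ji.
  by apply: Hv; rewrite ji ltn_ord.
elim: k => [_|k IH kK]; first by exists (fun=> x0); split => // i j; rewrite ltn0 andbF.
have [v [v1 Hv]] := IH (ltnW kK).
have [x [x1 Hx]] : exists x, NX x <= 1 /\ forall i, t <= NY (T x - T (v i)).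
  apply: contrapT => /forallNP H; apply: nc; exists (T \o v) => x x1.
  apply: contrapT => /forallNP H2; apply: (H x); split => // i.
  by rewrite leNgt; apply/negP => /ltW /H2.
exists (fun i : 'I_K => if i == k :> nat then x else v i); split.
  by move=> i; case: ifP.
move=> i j /andP[ji]; rewrite ltnS leq_eqVlt => /orP[/eqP ik|ik].
  by rewrite ik eqxx -ik (ltn_eqF ji).
by rewrite (ltn_eqF ik) (ltn_eqF (ltn_trans ji ik)); apply: Hv; rewrite ji.
Qed.

(* Words of length [l] over the alphabet [A] are spread over [l] blocks of [b]
   coordinates: in the [j]-th block the word [w] puts the vector [v (w j)] at
   position [pi (w j)]. *)
Lemma diag_cover_ge (R : realType) (p : R) (q : \bar R) (r : R)
    (X Y : lmodType R) (NX : X -> R) (NY : Y -> R) (T : {linear X -> Y})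
    (m n b l s : nat) (A : finType) (pi : A -> 'I_b) (v : A -> X) (t eps : R) :
  0 < p -> (0 < q)%E -> 0 < r -> quasi_norm NX -> quasi_norm NY -> r_normed r NY ->
  (0 < n)%N -> (l * b <= m)%N -> (4 * 2 ^ s <= #|A|)%N -> (2 * n <= s * l)%N ->
  (forall a, NX (v a) <= 1) -> 0 <= t ->
  (forall a a', a != a' ->
    t <= if pi a == pi a' then NY (T (v a) - T (v a')) else NY (T (v a))) ->
  ball_cover (lp_vec NX p%:E) (lp_vec NY q) (@diag_op R X Y T m) (2 ^ n.-1) eps ->
  t / (2 `^ r^-1 * 4 `^ inv_exp q) * l%:R `^ (inv_exp q - p^-1) <= eps.
Proof.
move=> p0 q0 r0 qX qY rY n0 lbm hA sl v1 t0 sep [ctr Hctr].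
have l0 : (0 < l)%N by rewrite lt0n; apply: contraTneq sl => ->; lia.
have lR : 0 < l%:R :> R by rewrite ltr0n.
(* Normalisation: [l] nonzero entries of norm at most [c] have l_p quasi-norm at most 1. *)
pose c : R := l%:R `^ (- p^-1).
have c0 : 0 < c by rewrite powR_gt0.
have idxP (w : {ffun 'I_l -> A}) (j : 'I_l) : (j * b + pi (w j) < m)%N.
  by have := ltn_ord j; have := ltn_ord (pi (w j)); nia.
pose idx w j := Ordinal (idxP w j).
have idxE w w' j j' : idx w j = idx w' j' -> j = j' /\ pi (w j) = pi (w' j').
  move=> /(congr1 val) /= E.
  have b0 : (0 < b)%N := leq_ltn_trans (leq0n _) (ltn_ord (pi (w j))).
  have jj : j = j'.
    apply/val_inj; have := congr1 (divn^~ b) E.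
    by rewrite /= !divnMDl // !divn_small ?ltn_ord // !addn0.
  by split=> //; apply/val_inj; move: E; rewrite jj => /addnI.
pose x (w : {ffun 'I_l -> A}) : {ffun 'I_m -> X} :=
  [ffun i => if [pick j | idx w j == i] is Some j then c *: v (w j) else 0].
have xidx w j : x w (idx w j) = c *: v (w j).
  rewrite ffunE; case: pickP => [j' /eqP/idxE[-> _] //|/(_ j)].
  by rewrite eqxx.
have xout w i : i \notin [set idx w j | j in predT] -> x w i = 0.
  move=> Hi; rewrite ffunE; case: pickP => // j' /eqP E.
  by move: Hi; rewrite -E imset_f.
have idx_inj w : injective (idx w) by move=> j j' /idxE[].
have x1 w : lp_vec NX p%:E (x w) <= 1.
  apply: (@lpnorm_le _ _ _ _
    (fun i => if i \in [set idx w j | j in predT] then l%:R^-1 else 0)) => //.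
  - by move=> i; case: ifP => // _; rewrite invr_ge0 ltW.
  - rewrite -big_mkcond /= sumr_const card_imset //= card_ord.
    by rewrite -[X in X <= _]mulr_natr mulVf ?gt_eqF.
  - by move=> i; exact: qnorm_ge0.
  move=> i; case: ifP => [/imsetP[j _ ->]|/negbT/xout ->]; last first.
    by rewrite (qnorm0 qX) mul1r powR_ge0.
  rewrite xidx (qnormZ qX) gtr0_norm // mul1r /=.
  rewrite -(@powR_inv1 _ l%:R) ?(ltW lR) // -powRrM mulN1r -/c.
  by rewrite ler_piMr // ltW.
have /choice[f Hf] w : exists i, lp_vec NY q (diag_op T (x w) - ctr i) <= eps.
  exact: Hctr.
have [w [w' [ff' Hd]]] := hamming_pigeonhole f n0 hA sl.
pose D0 := [set j | w j != w' j].
pose K : R := 2 `^ r^-1.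
pose D u := [set i | c * t / K <= NY ((diag_op T (x u) - ctr (f u)) i)].
have dE (z : {ffun 'I_m -> X}) (y : {ffun 'I_m -> Y}) i :
    (diag_op T z - y) i = T (z i) - y i by rewrite !ffunE.
(* Where the letters differ, the two images are at least c t apart at [idx w j]: with equal
   positions by separation, with different ones because [x w'] vanishes there. So one of them is far
   from the common centre. *)
have HD : (#|D0| <= #|D w| + #|D w'|)%N.
  rewrite -(card_imset D0 (idx_inj w)).
  apply: leq_trans (leq_card_setU _ _).
  apply/subset_leq_card/fintype.subsetP => _ /imsetP[j jD ->].
  rewrite !inE !dE -ff'; apply/orP.
  apply: (@r_normed_split _ _ _ qY r (c * t)  _ _ _ r0 rY); first by rewrite mulr_ge0 // ltW.
  move: jD; rewrite inE => /sep.
  case: eqP => [E|NE].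
    have -> : idx w j = idx w' j by apply/val_inj; rewrite /= E.
    rewrite xidx (_ : idx w' j = idx w j) ?xidx; last by apply/val_inj; rewrite /= E.
    rewrite !(linearZ_LR T) -scalerBr (qnormZ qY) gtr0_norm // => h.
    by rewrite ler_wpM2l // ltW.
  rewrite xidx (xout w'); last first.
    by apply/imsetP => -[j' _ /idxE[E1]]; move: NE; rewrite -E1.
  rewrite linear0 subr0 (linearZ_LR T) (qnormZ qY) gtr0_norm // => h.
  by rewrite ler_wpM2l // ltW.
have K0 : 0 < K by rewrite powR_gt0.
(* As l/2 <= |D0|, one of [D w], [D w'] has at least l/4 elements; this is the source of 4^(1/q). *)
have main u : (l <= 4 * #|D u|)%N ->
    t / (K * 4 `^ inv_exp q) * l%:R `^ (inv_exp q - p^-1) <= eps.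
  move=> lD; have iq0 : 0 <= inv_exp q.
    by case: (q) q0 => //= a; rewrite lte_fin invr_ge0 => /ltW.
  apply: le_trans (Hf u).
  have tK0 : 0 <= c * t / K by rewrite divr_ge0 ?mulr_ge0 // ltW.
  apply: le_trans (lpnorm_ge_card (D := D u) q0 tK0 _ _ _); first last.
  - by move=> i; rewrite inE.
  - by rewrite lt0n; apply: contraTneq lD => ->; rewrite muln0 -ltnNge.
  - by move=> i; exact: qnorm_ge0.
  have h : l%:R `^ inv_exp q <= 4 `^ inv_exp q * #|D u|%:R `^ inv_exp q :> R.
    rewrite -powRM // ler_powR2 ?ler0n //.
    by rewrite -natrM ler_nat.
  rewrite powRD; last by rewrite (gt_eqF lR) implybT.
  rewrite -/c invfM.
  have q4 : 0 < 4 `^ inv_exp q :> R by rewrite powR_gt0.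
  rewrite (_ : _ * _ = c * t / K * (l%:R `^ inv_exp q / 4 `^ inv_exp q)); last by ring.
  by apply: ler_wpM2l => //; rewrite ler_pdivrMr // mulrC.
have : (l <= 4 * #|D w|)%N || (l <= 4 * #|D w'|)%N by move: Hd; rewrite -/D0; lia.
by case/orP; apply: main.
Qed.

(** Here l is 2n/(t+1) rounded up and b is m/l rounded down. From m <= 2bl and l(t+1) <= 3n follows
    2^(t-1) (t+1) <= 6b, hence 2^t <= 6b; the 48 is 8 times 6. *)
Lemma word_shape_position (m n t : nat) : (2 <= n)%N -> (n <= m)%N -> (0 < t <= n)%N ->
  (2 ^ t.-1 * n <= m)%N ->
  exists l b, [/\ (0 < l)%N, (2 * n <= t.+1 * l)%N, (l * t.+1 <= 3 * n)%N,
    (l * b <= m)%N & (4 * 2 ^ t.+1 <= 48 * b)%N].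
Proof.
move=> n2 nm /andP[t1 tn] tm.
pose l := ((2 * n + t) %/ t.+1)%N.
have lt : (l * t.+1 <= 2 * n + t)%N by apply: leq_trunc_div.
have lt2 : (2 * n <= t.+1 * l)%N.
  by have := ltn_ceil (2 * n + t) (ltn0Sn t); rewrite -/l; nia.
have l0 : (0 < l)%N by rewrite lt0n; apply: contraTneq lt2 => ->; lia.
have ln : (l <= n)%N.
  by rewrite leqNgt; apply/negP => h; move: lt; nia.
pose b := (m %/ l)%N.
have bl : (l * b <= m)%N by rewrite mulnC leq_trunc_div.
have b1 : (0 < b)%N by rewrite divn_gt0 // (leq_trans ln).
have bl2 : (m <= 2 * (b * l))%N by have := ltn_ceil m l0; rewrite -/b; nia.
have b6 : (2 ^ t <= 6 * b)%N.
  have E : (2 ^ t = 2 * 2 ^ t.-1)%N by rewrite -expnS prednK.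
  have h1 : (2 ^ t.-1 * n * t.+1 <= 2 * (b * l) * t.+1)%N.
    by rewrite leq_mul2r (leq_trans tm) ?orbT.
  have h2 : (2 * (b * l) * t.+1 <= 2 * b * (3 * n))%N.
    by rewrite -!mulnA !leq_mul2l; apply/orP; right; apply/orP; right; lia.
  have h3 : (2 ^ t.-1 * t.+1 <= 6 * b)%N.
    rewrite -(@leq_pmul2r n) ?(ltn_trans _ n2) //.
    by rewrite mulnAC (_ : 6 * b * n = 2 * b * (3 * n))%N ?(leq_trans h1 h2) //; lia.
  by apply: leq_trans h3; rewrite E mulnC leq_mul2l ltnS t1 orbT.
exists l, b; split=> //; first by lia.
by rewrite expnS; lia.
Qed.

(** An alphabet of 2^(k-1) = 4 * 2^(k-3) separated points corresponds to s = k - 3; k >= 5 makes s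
    at least 2, which keeps l <= n. *)
Lemma word_shape_entropy (k n : nat) : (5 <= k <= n)%N ->
  exists l, [/\ (0 < l)%N, (2 * n <= (k - 3) * l)%N, (l <= n)%N & (l * k <= 8 * n)%N].
Proof.
move=> /andP[k5 kn].
pose l := ((2 * n + (k - 4)) %/ (k - 3))%N.
have k3 : (0 < k - 3)%N by lia.
have lt : (l * (k - 3) <= 2 * n + (k - 4))%N by apply: leq_trunc_div.
have lt2 : (2 * n <= (k - 3) * l)%N.
  by have := ltn_ceil (2 * n + (k - 4)) k3; rewrite -/l; nia.
have l0 : (0 < l)%N by rewrite lt0n; apply: contraTneq lt2 => ->; lia.
have ln : (l <= n)%N.
  by rewrite leqNgt; apply/negP => h; move: lt; nia.
have lk : (l * k <= 8 * n)%N by nia.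
by exists l.
Qed.

Lemma ler1_dist_nat (R : realType) (a b : nat) : a != b -> 1 <= `|a%:R - b%:R| :> R.
Proof.
wlog ltab : a b / (b < a)%N.
  move=> H ne; case: (ltngtP a b) (ne) => [h|h|->] //.
    by move=> _; rewrite distrC; apply: H; rewrite // eq_sym.
  by move=> _; exact: H.
by move=> _; rewrite -natrB ?(ltnW ltab) // normr_nat ler1n subn_gt0.
Qed.

Section LowerBound.
Variables (R : realType) (p : R) (q : \bar R) (r : R).
Hypotheses (p0 : 0 < p) (q0 : (0 < q)%E) (r0 : 0 < r) (al0 : 0 <= p^-1 - inv_exp q).
Variables (X Y : lmodType R) (NX : X -> R) (NY : Y -> R) (T : {linear X -> Y}).
Hypotheses (qX : quasi_norm NX) (qY : quasi_norm NY) (rY : r_normed r NY).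
Hypothesis bT : bounded_op NX NY T.
Variables (m n : nat) (eps : R).
Hypothesis eps0 : 0 < eps.
Hypothesis cov :
  ball_cover (lp_vec NX p%:E) (lp_vec NY q) (@diag_op R X Y T m) (2 ^ n.-1) eps.
Let alpha := p^-1 - inv_exp q.
Let C0 : R := 2 `^ r^-1 * 4 `^ inv_exp q.

Let C0_gt0 : 0 < C0. Proof. by rewrite mulr_gt0 // powR_gt0. Qed.

Let le_powRN (l : nat) (t x B : R) : (0 < l)%N -> 0 <= t -> 0 <= x -> 0 <= B ->
  l%:R * x <= B -> t / C0 * l%:R `^ (inv_exp q - p^-1) <= eps ->
  t * x `^ alpha <= C0 * B `^ alpha * eps.
Proof.
move=> l0 t0 x0 B0 lB; rewrite -opprB -/alpha powRN => H.
have lR : 0 < l%:R :> R by rewrite ltr0n.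
have la : 0 < l%:R `^ alpha :> R by rewrite powR_gt0.
have H1 : l%:R `^ alpha * x `^ alpha <= B `^ alpha.
  rewrite -powRM ?ler0n //; apply: ler_powR2 => //.
  by rewrite mulr_ge0.
move: H; rewrite ler_pdivrMr // ler_pdivrMr // => H.
apply: le_trans (ler_wpM2r (powR_ge0 _ _) H) _.
have -> : eps * l%:R `^ alpha * C0 * x `^ alpha =
  (l%:R `^ alpha * x `^ alpha) * (C0 * eps) by ring.
have -> : C0 * B `^ alpha * eps = B `^ alpha * (C0 * eps) by ring.
by apply: ler_wpM2r => //; rewrite mulr_ge0 // ltW.
Qed.

Lemma lower_opnorm (t : nat) : (2 <= n)%N -> (n <= m)%N ->
  (0 < t <= n)%N -> (2 ^ t.-1 * n <= m)%N ->
  opnorm NX NY T * (t.+1%:R / n%:R) `^ alpha <= 96 * C0 * 3 `^ alpha * eps.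
Proof.
move=> n2 nm /andP[t1 tn] tm.
have [l [b [l0 lt2 lt bl b48]]] := word_shape_position n2 nm (introT andP (conj t1 tn)) tm.
have [x0 [x01 Hx0]] := opnorm_half qX qY bT.
have o0 := opnorm_ge0 qX qY bT.
have main : opnorm NX NY T / 96 / C0 * l%:R `^ (inv_exp q - p^-1) <= eps.
  (* The letters are the multiples i/48 of [x0], i = 1, ..., 48, at [b] positions. The images have
     norm at least |T x0|/48, as do their differences at one position, and |T x0| is at least half
     the operator norm: hence 96. *)
  apply: (@diag_cover_ge R p q r X Y NX NY T m n b l t.+1 ('I_48 * 'I_b)%type
    (fun a => a.2) (fun a => (a.1.+1%:R / 48) *: x0)) => //.
  - exact: ltnW.
  - by rewrite card_prod !card_ord.
  - move=> a; rewrite (qnormZ qX) ger0_norm ?divr_ge0 //.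
    by rewrite mulr_ile1 ?divr_ge0 ?(qnorm_ge0 qX) // ler_pdivrMr // mul1r ler_nat.
  - lra.
  - move=> [a i] [a' i'] /= ne.
    have h48 : opnorm NX NY T / 96 <= 1 / 48 * NY (T x0) by lra.
    apply: le_trans h48 _.
    case: eqP => [E|_]; rewrite !(linearZ_LR T) -?scalerBl (qnormZ qY).
      apply: ler_wpM2r; first exact: qnorm_ge0.
      rewrite -mulrBl normrM (ger0_norm (_ : 0 <= 48^-1 :> R)) ?invr_ge0 //.
      rewrite ler_wpM2r ?invr_ge0 // ler1_dist_nat // eqSS.
      by apply: contraNneq ne => h; apply/eqP; rewrite E; congr pair; apply: val_inj.
    rewrite ger0_norm ?divr_ge0 //; apply: ler_wpM2r; first exact: qnorm_ge0.
    by rewrite ler_wpM2r ?invr_ge0 ?ler1n.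
have nR : 0 < n%:R :> R by rewrite ltr0n ltnW.
have h : l%:R * (t.+1%:R / n%:R) <= 3 :> R.
  by rewrite mulrA ler_pdivrMr // -!natrM ler_nat.
have := le_powRN l0 (divr_ge0 o0 (ler0n R 96)) (divr_ge0 (ler0n R _) (ler0n R _))
  (ler0n R 3) h main.
have -> : 96 * C0 * 3 `^ alpha * eps = C0 * 3 `^ alpha * eps * 96 by ring.
by rewrite mulrAC ler_pdivrMr.
Qed.

Lemma lower_entropy (k : nat) : (5 <= k <= n)%N -> (n <= m)%N ->
  (k%:R / n%:R) `^ alpha * entropy NX NY T k <= C0 * 8 `^ alpha * eps.
Proof.
move=> /andP[k5 kn] nm.
have k0 : (0 < k)%N by apply: leq_trans k5.
have nR : 0 < n%:R :> R by rewrite ltr0n (leq_trans k0).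
have kR : 0 < k%:R :> R by rewrite ltr0n.
have [l [l0 lt2 ln lk]] := word_shape_entropy (introT andP (conj k5 kn)).
(* Below [entropy NX NY T k] no cover by 2^(k-1) balls exists, so that many u-separated points do;
   they serve as letters with one position per block. *)
have main (u : R) : 0 < u -> u < entropy NX NY T k ->
    u * (k%:R / n%:R) `^ alpha <= C0 * 8 `^ alpha * eps.
  move=> u0 /(not_ball_cover u0) nc.
  have x0 : exists x, NX x <= 1 by exists 0; rewrite (qnorm0 qX).
  have [v [v1 Hv]] := separated_points x0 nc.
  apply: (@le_powRN l) => //; rewrite ?divr_ge0 ?(ltW u0) //.
    by rewrite mulrA ler_pdivrMr // -!natrM ler_nat.
  apply: (@diag_cover_ge R p q r X Y NX NY T m n 1 l (k - 3) 'I_(2 ^ k.-1)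
    (fun=> ord0) v) => //; [exact: leq_trans kn|by rewrite muln1 (leq_trans ln)| |exact: ltW|].
  - rewrite card_ord -[4%N]/(2 ^ 2)%N -expnD leq_pexp2l //; move: k5; clear; lia.
  - move=> i j ne; rewrite eqxx.
    case: (ltngtP i j) => h.
    + by rewrite -(qnormN qY) opprB; apply: Hv.
    + exact: Hv.
    + by move/val_inj: h ne => ->; rewrite eqxx.
set M := _ * _ * eps in main *.
have M0 : 0 < M by rewrite !mulr_gt0 // powR_gt0.
set Z := _ `^ alpha in main *.
have Z0 : 0 < Z by rewrite powR_gt0 // divr_gt0.
have MZ : 0 < M / Z by rewrite divr_gt0.
rewrite leNgt; apply/negP; rewrite mulrC -ltr_pdivrMr // => lt_e.
(* The midpoint of M/Z and the entropy number lies strictly below the latter and contradicts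
   [main]. *)
have /main : 0 < (M / Z + entropy NX NY T k) / 2 by lra.
have u1 : (M / Z + entropy NX NY T k) / 2 < entropy NX NY T k by lra.
move=> /(_ u1); rewrite -ler_pdivlMr //; lra.
Qed.

End LowerBound.

(** * Upper bound: patterns and their centres *)

(** With N = floor(n/(24t)) >= 1, m/N is at most 48 t 2^t, so the binomial is at most 2^(11tN). The
    product is at most 2^(12tN) <= 2^(n/2), and n/2 <= n - 1 since n >= 2. *)
Lemma pattern_budget (m n t : nat) : (2 <= n)%N -> (n <= m)%N -> (0 < t)%N ->
  (m < 2 ^ t * n)%N ->
  ('C(m + n %/ (24 * t), n %/ (24 * t)) * 2 ^ (n %/ (24 * t) * t) <= 2 ^ n.-1)%N.
Proof.
move=> n2 nm t0 mt; set N := (n %/ (24 * t))%N.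
have Nt : (24 * (N * t) <= n)%N by rewrite mulnCA leq_trunc_div.
have nN : (n < 24 * t * N.+1)%N.
  by rewrite mulnC; apply: ltn_ceil; rewrite muln_gt0.
have [N0|N0] := posnP N; first by rewrite N0 bin0 mul1n expn_gt0.
have Nm : (N <= m)%N by nia.
have mK : (m <= 48 * t * 2 ^ t * N)%N.
  have h : (2 ^ t * n <= 2 ^ t * (48 * t * N))%N by rewrite leq_mul2l; apply/orP; right; nia.
  by apply: leq_trans (ltnW mt) (leq_trans h _); rewrite mulnA [(2 ^ t * _)%N]mulnC.
apply: leq_trans (leq_mul (bin_leq_expn Nm mK) (leqnn _)) _.
have tt : (t <= 2 ^ t)%N by apply: ltnW; apply: ltn_expl.
have h1 : (8 * (48 * t * 2 ^ t) <= 2 ^ (11 * t))%N.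
  apply: (@leq_trans (2 ^ 9 * (2 ^ t * 2 ^ t))%N).
    by rewrite -[(2 ^ 9)%N]/(8 * 64)%N; nia.
  by rewrite -!expnD leq_pexp2l //; lia.
apply: (@leq_trans ((2 ^ (11 * t)) ^ N * 2 ^ (N * t))%N).
  by rewrite leq_mul2r leq_exp2r // h1 orbT.
by rewrite -expnM -expnD leq_pexp2l //; nia.
Qed.

(* The pattern [a] records [a i = floor (N * NX (x i) ^ p)], so [\sum a <= N]; a
   coordinate with [a i > 0] is approximated through a cover of [T (B_X)] by
   [2 ^ (a i * t)] balls, and one with [a i = 0] by the origin.  Either way the
   error at [i] is at most a constant times [B * (NX (x i) ^ p) ^ (1 / q)]. *)
Lemma diag_ball_cover (R : realType) (p : R) (q : \bar R)
    (X Y : lmodType R) (NX : X -> R) (NY : Y -> R) (T : {linear X -> Y})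
    (m n t : nat) (B : R) :
  let alpha := p^-1 - inv_exp q in
  0 < p -> (0 < q)%E -> 0 < alpha -> quasi_norm NX -> quasi_norm NY ->
  bounded_op NX NY T ->
  (2 <= n)%N -> (n <= m)%N -> (0 < t)%N -> (m < 2 ^ t * n)%N -> 0 <= B ->
  opnorm NX NY T * (t%:R / n%:R) `^ alpha <= B ->
  (forall k, (0 < k <= n)%N ->
    ball_cover NX NY T (2 ^ k.-1) (B * (n%:R / k%:R) `^ alpha)) ->
  ball_cover (lp_vec NX p%:E) (lp_vec NY q) (@diag_op R X Y T m) (2 ^ n.-1)
    (2 `^ p^-1 * 48 `^ alpha * B).
Proof.
move=> alpha p0 q0 al_gt0 qX qY bT n2 nm t0 mt B0 Hop Hcov.
have al0 := ltW al_gt0.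
pose N := (n %/ (24 * t))%N.
have Nt : (24 * (N * t) <= n)%N by rewrite mulnCA leq_trunc_div.
have nN : (n < 24 * t * N.+1)%N.
  by rewrite mulnC; apply: ltn_ceil; rewrite muln_gt0.
have budget := pattern_budget n2 nm t0 mt.
have Nm : (N <= m)%N by apply: leq_trans nm; apply: leq_div.
have nR : 0 < n%:R :> R by rewrite ltr0n ltnW.
have tR : 0 < t%:R :> R by rewrite ltr0n.
have iq0 : 0 <= inv_exp q.
  by case: (q) q0 => //= a; rewrite lte_fin invr_ge0 => /ltW.
have pE : p^-1 = alpha + inv_exp q by rewrite /alpha subrK.
have /choice[ctr Hctr] k : exists c : nat -> Y, (0 < k <= n)%N ->
    forall x, NX x <= 1 -> exists2 j, (j < 2 ^ k.-1)%N &
      NY (T x - c j) <= B * (n%:R / k%:R) `^ alpha.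
  have [kn|] := boolP (0 < k <= n)%N; last by exists (fun=> 0).
  have [c Hc] := Hcov k kn.
  (* Padding by 0 lets one sequence indexed by naturals hold the centres of every level k. *)
  exists (fun j => if insub j is Some i then c i else 0) => _ x /Hc[i Hi].
  by exists i => //; rewrite valK.
(* The bound on |x_i| known from the record a alone, since N |x_i|^p < a + 1; dividing by it brings
   x_i into the unit ball. *)
pose lam (a : nat) : R := (a.+1%:R / N%:R) `^ p^-1.
(* Level a t + 1 is used because the k-th entropy number allows 2^(k-1) balls. *)
pose center (s : m.-tuple 'I_N.+1 * {ffun 'I_m -> 'I_(2 ^ n)}) : {ffun 'I_m -> Y} :=
  [ffun i => if tnth s.1 i == 0 :> nat then 0
             else lam (tnth s.1 i) *: ctr (tnth s.1 i * t).+1 (s.2 i)].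
pose S := [set s : m.-tuple 'I_N.+1 * {ffun 'I_m -> 'I_(2 ^ n)} |
  (\sum_i tnth s.1 i <= N)%N && [forall i, (s.2 i < 2 ^ (tnth s.1 i * t))%N]].
have cardS : (#|S| <= 2 ^ n.-1)%N.
  exact: leq_trans (card_weighted_patterns _ _ Nm) budget.
exists (fun j => nth 0 [seq center s | s <- enum S] j) => x x1.
pose u i : R := NX (x i) `^ p.
have u0 i : 0 <= u i by apply: powR_ge0.
have su : \sum_i u i <= 1.
  have s0 : 0 <= \sum_i u i by apply: sumr_ge0.
  rewrite -(@powRKV _ (\sum_i u i) p) ?gt_eqF //.
  have E1 : 1 `^ p = 1 :> R by rewrite powR1.
  rewrite -[leRHS]E1; apply: ler_powR2 => //; [exact: ltW | exact: powR_ge0].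
have u1 i : u i <= 1.
  by apply: le_trans su; rewrite (bigD1 i) //= lerDl sumr_ge0.
pose a i := Num.truncn (N%:R * u i).
have aP i : (a i)%:R <= N%:R * u i < (a i).+1%:R.
  by apply: truncn_itv; rewrite mulr_ge0.
have sa : (\sum_i a i <= N)%N.
  rewrite -(ler_nat R) natr_sum; apply: (@le_trans _ _ (\sum_i N%:R * u i)).
    by apply: ler_sum => i _; case/andP: (aP i).
  by rewrite -mulr_sumr ler_piMr.
have aN i : (a i < N.+1)%N.
  by rewrite ltnS; apply: leq_trans sa; rewrite (bigD1 i) //= leq_addr.
have NXE i : NX (x i) = u i `^ alpha * u i `^ inv_exp q.
  have nX : 0 <= NX (x i) by apply: qnorm_ge0.
  have [ui0|ui0] := eqVneq (u i) 0.
    rewrite ui0 powR0 ?gt_eqF // mul0r; apply: (@powR_eq0_eq0 _ _ p).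
    exact: ui0.
  by rewrite -powRD ?ui0 ?implybT // -pE powRVK // gt_eqF.
pose err (i : 'I_m) (y : Y) :=
  NY (T (x i) - y) <= 2 `^ p^-1 * 48 `^ alpha * B * u i `^ inv_exp q.
have c2 : 1 <= 2 `^ p^-1 :> R.
  have E1 : 1 `^ p^-1 = 1 :> R by rewrite powR1.
  by rewrite -[leLHS]E1 ler_powR2 ?invr_ge0 ?(ltW p0) // ler1n.
have err0 i : a i = 0%N -> err i 0.
  move=> ai0; rewrite /err subr0.
  apply: le_trans (opnorm_ge qX qY bT _) _.
  rewrite NXE mulrA; apply: ler_wpM2r; first exact: powR_ge0.
  (* From n < 24t(N+1), N u_i < 1 and u_i <= 1 follows n u_i <= 24t(N u_i + u_i) <= 48t, also when N
     = 0. *)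
  have h : u i <= 48 * (t%:R / n%:R).
    rewrite mulrA ler_pdivlMr //.
    case/andP: (aP i) => _; rewrite ai0 => h1.
    apply: (@le_trans _ _ (u i * (24 * t * N.+1)%:R)).
      by rewrite ler_wpM2l // ler_nat ltnW.
    rewrite !natrM -natr1; have := u1 i; nra.
  have h2 : u i `^ alpha <= 48 `^ alpha * (t%:R / n%:R) `^ alpha.
    by rewrite -powRM ?divr_ge0 // ler_powR2.
  apply: (le_trans (ler_wpM2l (opnorm_ge0 qX qY bT) h2)).
  rewrite mulrCA -mulrA; apply: (@le_trans _ _ (48 `^ alpha * B)).
    by rewrite ler_wpM2l ?powR_ge0.
  by rewrite ler_peMl // mulr_ge0 ?powR_ge0.
have err1 i : (0 < a i)%N -> exists2 j, (j < 2 ^ (a i * t))%N &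
    err i (lam (a i) *: ctr (a i * t).+1 j).
  move=> ai0.
  have N0 : (0 < N)%N by apply: leq_trans ai0 (aN i).
  have NR : 0 < N%:R :> R by rewrite ltr0n.
  have aR : 0 < (a i)%:R :> R by rewrite ltr0n.
  have lam0 : 0 < lam (a i) by rewrite powR_gt0 // divr_gt0.
  have kn : (0 < (a i * t).+1 <= n)%N.
    apply/andP; split=> //.
    have h : (a i * t <= N * t)%N by rewrite leq_mul2r -ltnS aN orbT.
    by move: h Nt n2; clear; lia.
  have xl : NX ((lam (a i))^-1 *: x i) <= 1.
    rewrite (qnormZ qX) ger0_norm ?invr_ge0 ?(ltW lam0) // mulrC ler_pdivrMr // mul1r.
    rewrite -[X in X <= _](@powRVK _ _ p) ?(qnorm_ge0 qX) ?gt_eqF // -/(u i).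
    apply: ler_powR2; rewrite ?invr_ge0 ?(ltW p0) // ler_pdivlMr // mulrC.
    by case/andP: (aP i) => _ /ltW.
  have [j Hj HY] := Hctr _ kn _ xl; exists j => //.
  rewrite /err.
  have -> : T (x i) - lam (a i) *: ctr (a i * t).+1 j =
     lam (a i) *: (T ((lam (a i))^-1 *: x i) - ctr (a i * t).+1 j).
    by rewrite scalerBr (linearZ_LR T) scalerA divff ?scale1r // gt_eqF.
  rewrite (qnormZ qY) gtr0_norm //.
  apply: le_trans (ler_wpM2l (ltW lam0) HY) _.
  (* The constants come from n < 24t(N+1) <= 48tN here and from a + 1 <= 2a in [e2]. *)
  have e1 : (n%:R / (a i * t).+1%:R) `^ alpha <= 48 `^ alpha * (N%:R / (a i)%:R) `^ alpha.
    rewrite -powRM ?divr_ge0 //; apply: ler_powR2; rewrite ?divr_ge0 //.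
    rewrite ler_pdivrMr ?ltr0n // mulrA mulrAC ler_pdivlMr // -!natrM ler_nat.
    have h1 : (n * a i <= 24 * t * N.+1 * a i)%N by rewrite leq_mul2r (ltnW nN) orbT.
    by apply: leq_trans h1 _; move: N0; clear; nia.
  have e2 : lam (a i) <= 2 `^ p^-1 * ((a i)%:R / N%:R) `^ p^-1.
    rewrite -powRM ?divr_ge0 //; apply: ler_powR2; rewrite ?invr_ge0 ?divr_ge0 ?(ltW p0) //.
    rewrite mulrA ler_wpM2r ?invr_ge0 // -natrM ler_nat.
    by move: ai0; clear; lia.
  have e3 : ((a i)%:R / N%:R) `^ inv_exp q <= u i `^ inv_exp q.
    apply: ler_powR2; rewrite ?divr_ge0 // ler_pdivrMr // mulrC.
    by case/andP: (aP i).
  have e4 : ((a i)%:R / N%:R) `^ alpha * (N%:R / (a i)%:R) `^ alpha = 1.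
    by rewrite -powRM ?divr_ge0 // mulrA divfK ?gt_eqF // divff ?gt_eqF // powR1.
  have e5 : ((a i)%:R / N%:R) `^ p^-1 =
      ((a i)%:R / N%:R) `^ alpha * ((a i)%:R / N%:R) `^ inv_exp q.
    have ne : (a i)%:R / N%:R != 0 :> R by rewrite gt_eqF // divr_gt0.
    by rewrite -powRD ?ne ?implybT // -pE.
  (* As 1/p = alpha + 1/q, the factor (a/N)^alpha of [lam] cancels the growth (N/a)^alpha of the
     covering radius, leaving (a/N)^(1/q) <= u_i^(1/q). *)
  apply: (@le_trans _ _ ((2 `^ p^-1 * ((a i)%:R / N%:R) `^ p^-1) *
     (B * (48 `^ alpha * (N%:R / (a i)%:R) `^ alpha)))).
    apply: ler_pM => //; rewrite ?mulr_ge0 ?powR_ge0 ?(ltW lam0) //.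
    exact: ler_wpM2l.
  have -> : 2 `^ p^-1 * ((a i)%:R / N%:R) `^ p^-1 *
      (B * (48 `^ alpha * (N%:R / (a i)%:R) `^ alpha)) =
      2 `^ p^-1 * 48 `^ alpha * B * ((a i)%:R / N%:R) `^ inv_exp q *
      (((a i)%:R / N%:R) `^ alpha * (N%:R / (a i)%:R) `^ alpha) by rewrite e5; ring.
  by rewrite e4 mulr1; apply: ler_wpM2l => //; rewrite !mulr_ge0 ?powR_ge0.
have [f Hf] : exists f : {ffun 'I_m -> 'I_(2 ^ n)}, forall i,
    (f i < 2 ^ (a i * t))%N /\
    err i (if a i == 0%N then 0 else lam (a i) *: ctr (a i * t).+1 (f i)).
  have /choice[g Hg] i : exists j : 'I_(2 ^ n), (j < 2 ^ (a i * t))%N /\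
      err i (if a i == 0%N then 0 else lam (a i) *: ctr (a i * t).+1 j).
    have atn : (2 ^ (a i * t) <= 2 ^ n)%N.
      rewrite leq_pexp2l //.
      have h : (a i * t <= N * t)%N by rewrite leq_mul2r -ltnS aN orbT.
      by move: h Nt n2; clear; lia.
    have [ai0|ai0] := posnP (a i).
      have j0 : (0 < 2 ^ n)%N by rewrite expn_gt0.
      by exists (Ordinal j0); rewrite ai0 /= expn_gt0; split=> //; apply: err0.
    have [j Hj He] := err1 i ai0.
    by exists (Ordinal (leq_trans Hj atn)).
  by exists [ffun i => g i] => i; rewrite ffunE.
pose s := ([tuple Ordinal (aN i) | i < m], f).
have sS : s \in S.
  rewrite inE; apply/andP; split.
    by rewrite (eq_bigr a) // => i _; rewrite tnth_mktuple.
  by apply/forallP => i; rewrite tnth_mktuple; case: (Hf i).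
have szs : (index s (enum S) < 2 ^ n.-1)%N.
  by apply: leq_trans cardS; rewrite cardE index_mem mem_enum.
exists (Ordinal szs) => /=.
rewrite (nth_map s) ?index_mem ?mem_enum // nth_index ?mem_enum //.
apply: (lpnorm_le q0 _ u0 su).
- by rewrite !mulr_ge0 ?powR_ge0.
- by move=> i; exact: qnorm_ge0.
move=> i; have [_] := Hf i; rewrite /err.
by rewrite !ffunE tnth_mktuple.
Qed.

(** * Assembly of the two bounds *)

(** Lets the integer t = floor(log(m/n)) + 1 replace log(m/n) + 1 in both bounds. *)
Lemma log2_bounds (R : realType) (m n t : nat) : (0 < n)%N -> (0 < t)%N ->
  (2 ^ t.-1 * n <= m < 2 ^ t * n)%N ->
  t%:R <= log2 (m%:R / n%:R : R) + 1 <= t.+1%:R.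
Proof.
move=> n0 t0 /andP[lo hi].
have nR : 0 < n%:R :> R by rewrite ltr0n.
have m0 : (0 < m)%N by apply: leq_trans lo; rewrite muln_gt0 expn_gt0.
have mR : 0 < m%:R :> R by rewrite ltr0n.
have l2 : 0 < ln 2 :> R by rewrite ln_gt0 // ltr1n.
have lnp k : ln (2 ^ k)%:R = k%:R * ln 2 :> R by rewrite natrX lnXn // mulr_natl.
rewrite -natr1 lerD2r /log2 ler_pdivrMr // -lnp.
rewrite -[X in X%:R <= _](prednK t0) -natr1 lerD2r ler_pdivlMr // -lnp.
rewrite !ler_ln ?posrE ?divr_gt0 // ?ltr0n ?expn_gt0 //.
by rewrite ler_pdivlMr // ler_pdivrMr // -!natrM !ler_nat lo ltnW.
Qed.

Theorem theorem3p2 (R : realType) (p : R) (q : \bar R) (r : R) :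
  0 < p -> (p%:E < q)%E -> 0 < r <= 1 ->
  let alpha := p^-1 - inv_exp q in
  exists c1 c2 : R, 0 < c1 /\ 0 < c2 /\
  forall (m n : nat), (2 <= n)%N -> (n <= m)%N -> (m <= 2 ^ n)%N ->
  forall (X Y : lmodType R) (NX : X -> R) (NY : Y -> R) (T0 : {linear X -> Y}),
    rnormed_qBanach r NX -> rnormed_qBanach r NY -> bounded_op NX NY T0 ->
    let A := Aquant alpha n m (opnorm NX NY T0) (entropy NX NY T0) in
    let enTm := entropy (lp_vec NX p%:E) (lp_vec NY q) (@diag_op R X Y T0 m) n in
    c1 * A <= enTm /\ enTm <= c2 * A.
Proof.
move=> p0 pq /andP[r0 _] alpha.
have q0 : (0 < q)%E by apply: lt_trans pq; rewrite lte_fin.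
have al0 : 0 < alpha.
  rewrite subr_gt0; case: (q) pq => //= [s|_]; last by rewrite invr_gt0.
  by rewrite lte_fin => ps; rewrite ltf_pV2 // posrE ?(lt_trans p0 ps).
pose C0 : R := 2 `^ r^-1 * 4 `^ inv_exp q.
have C00 : 0 < C0 by rewrite mulr_gt0 // powR_gt0.
(* Collects the constants of both lower estimates; 4^alpha pays for the indices k < 5. *)
pose M : R := 96 * C0 * 3 `^ alpha * 4 `^ alpha * 8 `^ alpha.
have M0 : 0 < M by rewrite !mulr_gt0 // powR_gt0.
pose C : R := 2 `^ p^-1 * 48 `^ alpha.
have C_gt0 : 0 < C by rewrite mulr_gt0 // powR_gt0.
have pow1 (k : nat) : (0 < k)%N -> 1 <= k%:R `^ alpha :> R.
  move=> k0; have E1 : 1 `^ alpha = 1 :> R by rewrite powR1.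
  by rewrite -[leLHS]E1; apply: ler_powR2; rewrite ?ler1n // ltW.
exists M^-1, C; split; first by rewrite invr_gt0.
split=> // m n n2 nm m2n X Y NX NY T [qX _ _] [qY _ rY] bT A en.
have n0 : (0 < n)%N := ltnW n2.
have nR : 0 < n%:R :> R by rewrite ltr0n.
pose t := (trunc_log 2 (m %/ n)).+1.
have mn0 : (0 < m %/ n)%N by rewrite divn_gt0.
have /andP[t1 t2] := trunc_log_bounds (ltnSn 1) mn0.
have lo : (2 ^ t.-1 * n <= m)%N by rewrite -leq_divRL.
have hi : (m < 2 ^ t * n)%N by rewrite -ltn_divLR.
(* Here m <= 2^n enters: 2^(t-1) n <= 2^n < 2^n n. *)
have tn : (0 < t <= n)%N.
  rewrite /= -(@ltn_exp2l 2) // -(ltn_pmul2r n0).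
  apply: leq_ltn_trans (leq_trans lo m2n) _.
  by rewrite -[X in (X < _)%N]muln1 ltn_pmul2l ?expn_gt0.
have /andP[tL Lt] := @log2_bounds R m n t n0 isT (introT andP (conj lo hi)).
set L := log2 _ + 1 in tL Lt.
have L1 : 1 <= L by apply: le_trans tL; rewrite ler1n.
have o0 := opnorm_ge0 qX qY bT.
pose W := opnorm NX NY T * (L / n%:R) `^ alpha.
have AE : A = Num.max W
  (\big[Num.max/0]_(k < n) (((k.+1)%:R / n%:R) `^ alpha * entropy NX NY T k.+1)) by [].
have W0 : 0 <= W by rewrite mulr_ge0 ?powR_ge0.
have WA : W <= A by rewrite AE le_max lexx.
have A0 : 0 <= A := le_trans W0 WA.
have eA k : (0 < k <= n)%N -> entropy NX NY T k <= A * (n%:R / k%:R) `^ alpha.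
  case: k => // k /= kn; have kR : 0 < k.+1%:R :> R by rewrite ltr0n.
  have h : (k.+1%:R / n%:R) `^ alpha * entropy NX NY T k.+1 <= A.
    rewrite AE le_max; apply/orP; right.
    exact: (le_bigmax _ (fun k : 'I_n => (k.+1%:R / n%:R) `^ alpha *
      entropy NX NY T k.+1) (Ordinal kn)).
  have h2 := ler_wpM2r (powR_ge0 (n%:R / k.+1%:R) alpha) h.
  apply: le_trans h2; rewrite mulrAC -powRM ?divr_ge0 //.
  by rewrite mulrA divfK ?gt_eqF // divff ?gt_eqF // powR1 mul1r.
(* The strict inequality leaves room because the infimum defining an entropy number need not be
   attained. *)
have cover B : A < B ->
    ball_cover (lp_vec NX p%:E) (lp_vec NY q) (@diag_op R X Y T m) (2 ^ n.-1) (C * B).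
  move=> AB; apply: (@diag_ball_cover _ _ _ _ _ _ _ _ _ _ t) => //.
  - exact: le_trans A0 (ltW AB).
  - apply: le_trans (le_trans WA (ltW AB)); apply: ler_wpM2l => //.
    apply: ler_powR2; rewrite ?divr_ge0 ?(ltW al0) //.
    by rewrite ler_wpM2r ?invr_ge0.
  move=> k /andP[k0 kn].
  have oC : 0 < opnorm NX NY T + 1 by rewrite ltr_wpDl.
  apply: (entropy_lt_cover oC).
    apply: ball_cover_bound => x x1.
    by rewrite (le_trans (opnorm_ge1 qX bT x1)) // lerDl.
  apply: le_lt_trans (eA k _) _; first by rewrite k0.
  by rewrite ltr_pM2r // powR_gt0 // divr_gt0 ?ltr0n.
split; last first.
  apply/ler_addgt0Pr => e e0.
  have AB : A < A + e / C by rewrite ltrDl divr_gt0.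
  have -> : C * A + e = C * (A + e / C) by rewrite mulrDr mulrCA divff ?mulr1 ?gt_eqF.
  apply: entropy_le; last exact: cover.
  by rewrite mulr_gt0 // (le_lt_trans A0).
have AB : A < A + 1 by rewrite ltrDl.
apply: (le_entropy _ (cover _ AB)); first by rewrite mulr_gt0 // (le_lt_trans A0).
move=> eps e0 cov; rewrite mulrC ler_pdivrMr // mulrC.
have Wle : W <= 96 * C0 * 3 `^ alpha * eps.
  apply: le_trans (lower_opnorm p0 q0 r0 (ltW al0) qX qY rY bT e0 cov n2 nm tn lo).
  apply: ler_wpM2l => //; apply: ler_powR2; rewrite ?divr_ge0 ?(ltW al0) //.
    by rewrite (le_trans _ L1).
  by rewrite ler_wpM2r ?invr_ge0.
have h4 := pow1 4%N isT; have h8 := pow1 8%N isT; have h3 := pow1 3%N isT.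
have Ce : 0 < C0 * eps by rewrite mulr_gt0.
have W4 : 4 `^ alpha * W <= M * eps.
  apply: le_trans (ler_wpM2l (powR_ge0 _ _) Wle) _.
  have -> : M * eps = 8 `^ alpha * (4 `^ alpha * (96 * C0 * 3 `^ alpha * eps)).
    by rewrite /M; ring.
  by rewrite ler_peMl // !mulr_ge0 ?powR_ge0 // ltW.
have WM : W <= M * eps by apply: le_trans W4; rewrite ler_peMl.
rewrite AE ge_max WM /=; apply: bigmax_le => [|k _].
  by rewrite mulr_ge0 ?ltW.
have [k5|k5] := leqP 5 k.+1.
  have kk : (5 <= k.+1 <= n)%N by rewrite k5 ltn_ord.
  apply: le_trans (lower_entropy p0 q0 r0 (ltW al0) qX qY rY e0 cov kk nm) _.
  have -> : M * eps = (96 * 3 `^ alpha * 4 `^ alpha) * (C0 * 8 `^ alpha * eps).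
    by rewrite /M; ring.
  rewrite ler_peMl //; first by rewrite !mulr_ge0 ?powR_ge0 ?ltW.
  by rewrite !mulr_ege1 // ler1n.
(* For k <= 4 the entropy number is at most the operator norm, and k <= 4 <= 4L, where L = log(m/n)
   + 1 >= 1. *)
apply: le_trans W4; rewrite mulrCA mulrC.
apply: ler_pM; rewrite ?powR_ge0 ?entropy_ge0 //.
  apply: entropy_le_bound => // x x1; exact: (opnorm_ge1 qX bT x1).
rewrite -powRM ?divr_ge0 ?(le_trans _ L1) //.
apply: ler_powR2; rewrite ?divr_ge0 ?(ltW al0) //.
rewrite mulrA ler_wpM2r ?invr_ge0 //.
apply: le_trans (_ : 4 * 1 <= _); last by rewrite ler_wpM2l.
by rewrite mulr1 ler_nat.
Qed.
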